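(* Let $P$ and $Q$ be lattice paths from $(0,0)$ to $(n-r,r)$ with $P$ never rising above $Q$. Then the lattice path matroid $M[P,Q]$ and the rook matroid $R[P,Q]$ have the same configuration.
   Context: A lattice path is a word in the letters $N$ (unit step north) and $E$ (unit step east), read as a path from $(0,0)$. For lattice paths $P,Q$ of length $n$ from $(0,0)$ to $(m,r)$, $m=n-r$, with $P$ never above $Q$, let $u_1<\cdots<u_r$ be the positions of the north steps of $P$ and $l_1<\cdots<l_r$ those of $Q$, and $N_i=\{l_i,\ldots,u_i\}$; $M[P,Q]$ is the transversal matroid on $[n]$ whose independent sets are the partial transversals of $(N_1,\ldots,N_r)$ (sets $I$ with an injection $\phi:I\to[r]$, $e\in N_{\phi(e)}$). The diagram of $(P,Q)$ is the set of unit squares lying between $P$ and $Q$. Label the rows (horizontal strips $i-1\le y\le i$) by $1,\ldots,r$ from bottom to top and the columns (vertical strips $j-1\le x\le j$) by $r+1,\ldots,r+m=n$ from left to right. For $i\in[r]$ let $A_i$ consist of $i$ together with the labels of all columns that contain a square of the diagram in row $i$. The rook matroid $R[P,Q]$ is the transversal matroid on $[n]$ whose independent sets are the partial transversals of $(A_1,\ldots,A_r)$. Cyclic flats are flats that are unions of circuits, forming a lattice $\mathcal{Z}(M)$ under inclusion. Matroids $M,N$ have the same configuration if $|E(M)|=|E(N)|$ and there is a lattice isomorphism $\Phi:\mathcal{Z}(M)\to\mathcal{Z}(N)$ with $|\Phi(F)|=|F|$ and $r_N(\Phi(F))=r_M(F)$ for all $F$. *)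

(* Defs.v *)
From HB Require Import structures.
From mathcomp Require Import all_boot order.

Set Implicit Arguments.
Unset Strict Implicit.
Unset Printing Implicit Defensive.

(* A matroid whose ground set is the whole finite type T. *)
Record matroid (T : finType) := Matroid {
  indep : pred {set T};
  indep0 : indep set0;
  indepS : forall I J : {set T}, I \subset J -> indep J -> indep I;
  indep_aug : forall I J : {set T}, indep I -> indep J -> #|I| < #|J| ->
    exists2 e, e \in J :\: I & indep (e |: I)
}.

Section MatroidNotions.
Variables (T : finType) (M : matroid T).
Implicit Types (e f : T) (I J X Y C F G H : {set T}).

Definition rank X : nat := \max_(I : {set T} | indep M I && (I \subset X)) #|I|.

Definition circuit C : bool := minset (fun X => ~~ indep M X) C.

Definition cl X : {set T} := [set e | rank (e |: X) == rank X].

Definition flat F : bool := [forall e, (e \notin F) ==> (rank F < rank (e |: F))].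

Definition cyclic X : bool :=
  [exists S : {set {set T}}, [forall C in S, circuit C] && (cover S == X)].

(* The largest cyclic subset of X. *)
Definition cyclic_part X : {set T} :=
  \bigcup_(C : {set T} | circuit C && (C \subset X)) C.

Record cyclic_flat := CyclicFlat {
  cflat_set :> {set T};
  cflat_setP : flat cflat_set && cyclic cflat_set
}.

HB.instance Definition _ := [isSub for cflat_set].
HB.instance Definition _ := [Finite of cyclic_flat by <:].

Lemma rank_basis X : exists2 B, indep M B && (B \subset X) & #|B| = rank X.
Proof.
rewrite /rank; have h0 : indep M set0 && (set0 \subset X) by rewrite indep0 sub0set.
have h1 : 0 < #|[pred I | indep M I && (I \subset X)]| by apply/card_gt0P; exists set0.
by have [B HB ->] := eq_bigmax_cond (fun I : {set T} => #|I|) h1; exists B.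
Qed.

Lemma leq_rank I X : indep M I -> I \subset X -> #|I| <= rank X.
Proof.
by move=> hI sIX; rewrite /rank (bigmax_sup I) ?hI.
Qed.

Lemma rankS X Y : X \subset Y -> rank X <= rank Y.
Proof.
move=> sXY; have [B /andP[hB sBX] <-] := rank_basis X.
exact: leq_rank hB (subset_trans sBX sXY).
Qed.

Lemma extend_basis I X : indep M I -> I \subset X ->
  exists B, [/\ indep M B, I \subset B, B \subset X & #|B| = rank X].
Proof.
move=> hI sIX; have [n le_n] := ubnP (rank X - #|I|).
elim: n I hI sIX le_n => // n IHn I hI sIX le_n.
have [le_r|lt_r] := leqP (rank X) #|I|.
  by exists I; split=> //; apply/eqP; rewrite eqn_leq le_r leq_rank.
have [B /andP[hB sBX] cB] := rank_basis X; rewrite -cB in lt_r.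
have [e] := indep_aug hI hB lt_r; rewrite inE => /andP[eNI eB] heI.
have sX : e |: I \subset X by rewrite subUset sub1set (subsetP sBX).
have [|B' [hB' sI' sB' cB']] := IHn (e |: I) heI sX.
  by rewrite cardsU1 eNI; rewrite cB in lt_r; move: le_n; rewrite ltnS;
     apply: leq_trans; rewrite ltn_sub2l.
by exists B'; split=> //; apply: subset_trans sI'; apply: subsetUr.
Qed.

Lemma closureP X e :
  reflect (e \in X \/ exists2 C, circuit C & (e \in C) && (C \subset e |: X))
          (e \in cl X).
Proof.
rewrite inE; apply: (iffP eqP) => [rk|].
  have [eX|eNX] := boolP (e \in X); [by left | right].
  have [B /andP[hB sBX] cB] := rank_basis X.
  have depB : ~~ indep M (e |: B).
    apply/negP=> /leq_rank/(_ (setUS [set e] sBX)); rewrite rk -cB cardsU1.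
    by rewrite (contra (subsetP sBX e) eNX) add1n ltnn.
  have [C mC sCB] := minset_exists (P := fun Y => ~~ indep M Y) depB.
  exists C => //; apply/andP; split; last exact: subset_trans sCB (setUS _ sBX).
  apply: contraT => eNC; have /negP[] := minsetp mC.
  apply: indepS hB; apply/subsetP=> x xC; have := subsetP sCB x xC.
  by rewrite !inE => /predU1P[xe|//]; rewrite -xe xC in eNC.
case=> [eX|[C mC /andP[eC sC]]]; first by rewrite (setUidPr _) // sub1set.
apply/eqP; rewrite eqn_leq (rankS (subsetUr _ _)) andbT leqNgt; apply/negP=> lt_r.
have hI : indep M (C :\ e).
  apply: contraT => /(minsetinf mC)/(_ (subD1set C e)) CeE.
  by move: eC; rewrite -CeE !inE eqxx.
have sIX : C :\ e \subset X.
  by apply/subsetP=> x; rewrite !inE => /andP[/negPf xe /(subsetP sC)]; rewrite !inE xe.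
have [B [hB sIB sBX cB]] := extend_basis hI sIX.
have [J /andP[hJ sJ] cJ] := rank_basis (e |: X).
rewrite -cB -cJ in lt_r; have [f] := indep_aug hB hJ lt_r.
rewrite inE => /andP[fNB /(subsetP sJ)]; rewrite !inE => /predU1P[-> heB|fX hfB].
  have /negP[] := minsetp mC; apply: indepS heB; apply/subsetP=> x xC.
  by rewrite !inE; case: eqVneq => //= xe; rewrite (subsetP sIB) // !inE xe.
have sfX : f |: B \subset X by rewrite subUset sub1set fX.
by have := leq_rank hfB sfX; rewrite -cB cardsU1 fNB add1n ltnn.
Qed.

Lemma sub_closure X : X \subset cl X.
Proof. by apply/subsetP=> x xX; apply/closureP; left. Qed.

Lemma closureS X Y : X \subset Y -> cl X \subset cl Y.
Proof.
move=> sXY; apply/subsetP=> x /closureP[/(subsetP sXY) xY|[C mC /andP[xC sC]]].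
  by apply/closureP; left.
by apply/closureP; right; exists C; rewrite // xC (subset_trans sC) ?setUS.
Qed.

Lemma rank_closure X : rank (cl X) = rank X.
Proof.
have [B [hB _ sBX cB]] := extend_basis (indep0 M) (sub0set X).
apply/eqP; rewrite eqn_leq (rankS (sub_closure X)) andbT leqNgt -cB; apply/negP.
have [J /andP[hJ sJ] <-] := rank_basis (cl X) => lt_r.
have [f] := indep_aug hB hJ lt_r; rewrite inE => /andP[fNB /(subsetP sJ)].
rewrite inE => /eqP fX hfB.
by have := leq_rank hfB (setUS _ sBX); rewrite fX -cB cardsU1 fNB add1n ltnn.
Qed.

Lemma closureK X : cl (cl X) = cl X.
Proof.
apply/eqP; rewrite eqEsubset sub_closure andbT; apply/subsetP=> e.
rewrite !inE rank_closure => /eqP rk; rewrite eqn_leq (rankS (subsetUr _ _)) andbT.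
by rewrite -rk; apply/rankS/setUS/sub_closure.
Qed.

Lemma flatE F : flat F = (cl F \subset F).
Proof.
apply/forallP/subsetP => [hF e|sF e].
  by rewrite inE => /eqP rk; apply: contraT => /(implyP (hF e)); rewrite rk ltnn.
apply/implyP=> eF; rewrite ltn_neqAle (rankS (subsetUr _ _)) andbT eq_sym.
by apply: contra eF => rk; apply: sF; rewrite inE.
Qed.

Lemma flat_closure X : flat (cl X).
Proof. by rewrite flatE closureK. Qed.

Lemma flatI F G : flat F -> flat G -> flat (F :&: G).
Proof.
rewrite !flatE => hF hG; rewrite subsetI.
by rewrite (subset_trans (closureS (subsetIl F G))) // (subset_trans (closureS (subsetIr F G))).
Qed.

Lemma cyclic_part_sub X : cyclic_part X \subset X.
Proof. by apply/bigcupsP=> C /andP[]. Qed.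

Lemma circuit_cyclic_part C X : circuit C -> C \subset X -> C \subset cyclic_part X.
Proof. by move=> hC sCX; apply: bigcup_sup; rewrite hC. Qed.

Lemma cyclicP X : reflect (cyclic_part X = X) (cyclic X).
Proof.
apply: (iffP existsP) => [[S /andP[/forall_inP hS /eqP <-]]|<-].
  apply/eqP; rewrite eqEsubset cyclic_part_sub; apply/bigcupsP=> C CS.
  exact/circuit_cyclic_part/bigcup_sup/CS/hS.
exists [set C : {set T} | circuit C & C \subset X]; apply/andP; split.
  by apply/forall_inP=> C; rewrite inE => /andP[].
by rewrite /cover; apply/eqP/eq_bigl=> C; rewrite inE.
Qed.

Lemma cyclic_part_mono X Y : X \subset Y -> cyclic_part X \subset cyclic_part Y.
Proof.
move=> sXY; apply/bigcupsP=> C /andP[hC sC].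
exact: circuit_cyclic_part hC (subset_trans sC sXY).
Qed.

Lemma cyclic_cyclic_part X : cyclic (cyclic_part X).
Proof.
apply/cyclicP/eqP; rewrite eqEsubset cyclic_part_sub; apply/bigcupsP=> C /andP[hC sC].
exact/circuit_cyclic_part/circuit_cyclic_part.
Qed.

Lemma cyclicU X Y : cyclic X -> cyclic Y -> cyclic (X :|: Y).
Proof.
move=> /cyclicP hX /cyclicP hY; apply/cyclicP/eqP.
by rewrite eqEsubset cyclic_part_sub subUset -{1}hX -{2}hY !cyclic_part_mono
  ?subsetUl ?subsetUr.
Qed.

Lemma cyclic_closure X : cyclic X -> cyclic (cl X).
Proof.
move=> /cyclicP hX; apply/cyclicP/eqP; rewrite eqEsubset cyclic_part_sub.
have sX := cyclic_part_mono (sub_closure X); rewrite hX in sX.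
apply/subsetP=> e ecl; have /closureP[/(subsetP sX)//|[C hC /andP[eC sC]]] := ecl.
apply: (subsetP (circuit_cyclic_part hC _)) (eC); apply: subset_trans sC _.
by rewrite subUset sub1set ecl sub_closure.
Qed.

Lemma flat_cyclic_part F : flat F -> flat (cyclic_part F).
Proof.
rewrite !flatE => hF; apply/subsetP=> e ecl; have /closureP[//|[C hC /andP[eC sC]]] := ecl.
have eF : e \in F by apply/(subsetP hF)/(subsetP (closureS (cyclic_part_sub F))).
apply: (subsetP (circuit_cyclic_part hC _)) (eC); apply: subset_trans sC _.
by rewrite subUset sub1set eF cyclic_part_sub.
Qed.

Fact cflat_join_proof (F G : cyclic_flat) :
  flat (cl (F :|: G)) && cyclic (cl (F :|: G)).
Proof.
case: F G => F /andP[_ cF] [G /andP[_ cG]] /=.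
by rewrite flat_closure cyclic_closure ?cyclicU.
Qed.

Fact cflat_meet_proof (F G : cyclic_flat) :
  flat (cyclic_part (F :&: G)) && cyclic (cyclic_part (F :&: G)).
Proof.
case: F G => F /andP[fF _] [G /andP[fG _]] /=.
by rewrite flat_cyclic_part ?flatI ?cyclic_cyclic_part.
Qed.

Definition cflat_le (F G : cyclic_flat) : bool := F \subset G.
Definition cflat_join (F G : cyclic_flat) := CyclicFlat (cflat_join_proof F G).
Definition cflat_meet (F G : cyclic_flat) := CyclicFlat (cflat_meet_proof F G).

Fact cflat_le_refl : reflexive cflat_le. Proof. by move=> F; apply: subxx. Qed.

Fact cflat_le_anti : antisymmetric cflat_le.
Proof. by move=> F G; rewrite /cflat_le -eqEsubset => /eqP/val_inj. Qed.

Fact cflat_le_trans : transitive cflat_le.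
Proof. by move=> G F H; apply: subset_trans. Qed.

Fact cflat_meetP (F G H : cyclic_flat) :
  cflat_le F (cflat_meet G H) = cflat_le F G && cflat_le F H.
Proof.
rewrite /cflat_le /= -subsetI; apply/idP/idP => [sF|].
  exact: subset_trans sF (cyclic_part_sub _).
case: F => F /= /andP[_ /cyclicP cF] /cyclic_part_mono; by rewrite cF.
Qed.

Fact cflat_joinP (F G H : cyclic_flat) :
  cflat_le (cflat_join F G) H = cflat_le F H && cflat_le G H.
Proof.
rewrite /cflat_le /= -subUset; apply/idP/idP => [|/closureS sH].
  exact: subset_trans (sub_closure _).
case: H sH => H /= /andP[]; rewrite flatE => fH _ sH; exact: subset_trans sH fH.
Qed.

HB.instance Definition _ := Order.Le_isPOrder.Build (Order.Disp tt tt) cyclic_flat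
  cflat_le_refl cflat_le_anti cflat_le_trans.
HB.instance Definition _ := Order.POrder_MeetJoin_isLattice.Build (Order.Disp tt tt)
  cyclic_flat cflat_meetP cflat_joinP.

Lemma cflat_leE (F G : cyclic_flat) : (F <= G)%O = (F \subset G).
Proof. by []. Qed.

Lemma cflat_meetE (F G : cyclic_flat) :
  (F `&` G)%O = cyclic_part (F :&: G) :> {set T}.
Proof. by []. Qed.

Lemma cflat_joinE (F G : cyclic_flat) :
  (F `|` G)%O = cl (F :|: G) :> {set T}.
Proof. by []. Qed.

End MatroidNotions.

Definition same_configuration (T U : finType) (M : matroid T) (N : matroid U) : Prop :=
  #|T| = #|U| /\
  exists Phi : cyclic_flat M -> cyclic_flat N,
    [/\ bijective Phi,
        {morph Phi : F G / (F `&` G)%O},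
        {morph Phi : F G / (F `|` G)%O},
        forall F, #|Phi F| = #|F|
      & forall F, rank N (Phi F) = rank M F].

Section Transversal.
Variables (T J : finType) (A : J -> {set T}).
Implicit Types (I K : {set T}) (e : T).

Definition partial_transversal I : bool :=
  [exists phi : {ffun {e : T | e \in I} -> J},
    injectiveb phi && [forall e, val e \in A (phi e)]].

(* The matching as a function that is also defined, as None, outside I. *)
Definition matches I (phi : T -> option J) : Prop :=
  {in I, forall e, exists2 j, phi e = Some j & e \in A j} /\ {in I &, injective phi}.

Lemma partial_transversalP I :
  reflect (exists phi, matches I phi) (partial_transversal I).
Proof.
apply: (iffP existsP) => [[phi /andP[/injectiveP phi_inj /forallP phiA]]|[phi [phiA phi_inj]]].
  exists (fun e => omap phi (insub e)); split=> [e eI|e f eI fI].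
    by rewrite insubT /=; exists (phi (Sub e eI)) => //; apply: (phiA (Sub e eI)).
  by rewrite !insubT /= => -[/phi_inj/(congr1 val)].
have ex (e : {e : T | e \in I}) : exists j, (phi (val e) == Some j) && (val e \in A j).
  by have [j -> eA] := phiA _ (valP e); exists j; rewrite eqxx.
exists [ffun e => xchoose (ex e)]; apply/andP; split.
  apply/injectiveP=> e f; rewrite !ffunE => eq_ef; apply/val_inj/phi_inj.
  - exact: valP.
  - exact: valP.
  have /andP[/eqP he _] := xchooseP (ex e); have /andP[/eqP hf _] := xchooseP (ex f).
  exact: etrans (etrans he (congr1 Some eq_ef)) (esym hf).
by apply/forallP=> e; rewrite ffunE; have /andP[] := xchooseP (ex e).
Qed.

Fact partial_transversal0 : partial_transversal set0.
Proof. by apply/partial_transversalP; exists (fun=> None); split=> e; rewrite inE. Qed.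

Fact partial_transversalS I K :
  I \subset K -> partial_transversal K -> partial_transversal I.
Proof.
move=> /subsetP sIK /partial_transversalP[phi [phiA phi_inj]].
apply/partial_transversalP; exists phi; split=> [e /sIK/phiA//|e f /sIK eK /sIK fK].
exact: phi_inj.
Qed.

Fact partial_transversal_aug I K :
  partial_transversal I -> partial_transversal K -> #|I| < #|K| ->
  exists2 e, e \in K :\: I & partial_transversal (e |: I).
Proof.
move=> /partial_transversalP[phi mphi] /partial_transversalP[psi [psiA psi_inj]] ltIK.
have [n] := ubnP #|[set e in I :&: K | phi e != psi e]|.
elim: n phi mphi => // n IHn phi [phiA phi_inj] le_n.
have [e eK eN] : exists2 e, e \in K & psi e \notin [set phi x | x in I].
  apply/exists_inP; rewrite -negb_forall_in; apply/negP=> /forall_inP sub.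
  suff: #|K| <= #|I| by rewrite leqNgt ltIK.
  rewrite -(card_in_imset psi_inj) -(card_in_imset phi_inj); apply: subset_leq_card.
  by apply/subsetP=> _ /imsetP[x xK ->]; apply: sub.
pose phi' x := if x == e then psi e else phi x.
have eNphi x : x \in I -> phi x <> psi e.
  by move=> xI eq_x; case/negP: eN; rewrite -eq_x imset_f.
have m' : matches (e |: I) phi'.
  rewrite /phi'; split=> [x|x y].
    rewrite !inE; case: eqP => [-> _|_ /= xI]; [exact: psiA | exact: phiA].
  rewrite !inE; do 2!case: eqP => [->|_] //=.
  - by move=> _ yI /esym/eNphi[].
  - by move=> xI _ /eNphi[].
  exact: phi_inj.
have [eI|eNI] := boolP (e \in I); last first.
  by exists e; [rewrite inE eNI | apply/partial_transversalP; exists phi'].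
rewrite (setUidPr _) ?sub1set // in m'; apply: (IHn phi' m').
rewrite -ltnS (leq_trans _ le_n) // ltnS; apply/proper_card/properP; split.
  by apply/subsetP=> x; rewrite !inE /phi'; case: (x =P e) => // ->; rewrite eqxx andbF.
exists e; first by rewrite !inE eI eK; apply/eqP/eNphi.
by rewrite !inE /phi' !eqxx andbF.
Qed.

Definition transversal_matroid : matroid T :=
  Matroid partial_transversal0 partial_transversalS partial_transversal_aug.

End Transversal.

Variant step := North | East.

Definition is_north (s : step) : bool := if s is North then true else false.

Fact is_northK : cancel is_north (fun b : bool => if b then North else East).
Proof. by case. Qed.

HB.instance Definition _ := Equality.copy step (can_type is_northK).

(* Positions, steps, rows and columns are all numbered from 0 instead of 1;
   the k-th step (k < n) of a path w is nth East w k, and e : 'I_n stands for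
   the element e + 1 of [n]. *)
Section Paths.
Implicit Types w P Q : seq step.

Definition endpoint w : nat * nat := (count_mem East w, count_mem North w).

Definition height w k : nat := count_mem North (take k w).

Definition never_above P Q : Prop := forall k, height P k <= height Q k.

Definition step_positions (s : step) w : seq nat :=
  [seq k <- iota 0 (size w) | nth East w k == s].

Definition north_pos w i : nat := nth 0 (step_positions North w) i.
Definition east_pos w j : nat := nth 0 (step_positions East w) j.

(* The height at which w crosses the vertical strip j <= x <= j + 1. *)
Definition column_height w j : nat := height w (east_pos w j).

(* The square [j, j + 1] x [i, i + 1] lies above P and below Q. *)
Definition in_diagram P Q i j : bool :=
  (column_height P j <= i) && (i.+1 <= column_height Q j).

End Paths.

Section PathMatroids.
Variables (n r : nat) (P Q : n.-tuple step).

Definition lpm_set (i : 'I_r) : {set 'I_n} :=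
  [set e : 'I_n | north_pos Q i <= e <= north_pos P i].

Definition lattice_path_matroid : matroid 'I_n := transversal_matroid lpm_set.

(* Rows carry the labels 0, ..., r - 1 and columns the labels r, ..., n - 1. *)
Definition rook_set (i : 'I_r) : {set 'I_n} :=
  [set e : 'I_n | (e == i :> nat) ||
    [exists j : 'I_(n - r), (e == r + j :> nat) && in_diagram P Q i j]].

Definition rook_matroid : matroid 'I_n := transversal_matroid rook_set.

End PathMatroids.

Arguments lattice_path_matroid {n} r P Q.
Arguments rook_matroid {n} r P Q.

(* Main.v *)
Require Import Defs.
From mathcomp Require Import all_boot order zify.

(* In a transversal matroid with presentation (A_j), let N(e) be the set of
   indices j with e in A_j, and for a set S of indices let
   G(S) = {e : N(e) is contained in S}. By Hall's theorem the cyclic flats are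
   exactly the sets G(S) where the deficiency |G(S)| - |S| strictly exceeds that
   of every proper subset of S; such a flat has rank |S|. So the configuration
   only depends on the deficiencies f(S).

   In the lattice path matroid N(e) is the interval of rows
   [height of P before step e, height of Q after step e); in the rook matroid it
   is {i} for a row label i and [c_P(j), c_Q(j)) for a column label j, where c_P
   and c_Q are the heights at which the paths cross column j. Over one maximal
   interval of consecutive rows in S that has length k, the contribution to f(S)
   is, for some integer d, max(-k, d) in the lattice path matroid and max(0, d)
   in the rook matroid. Hence f_LPM <= f_rook, with equality when every such
   interval contains some nonempty [c_P(j), c_Q(j)), which is the case for the S
   giving cyclic flats of the rook matroid. As f_rook is monotone, the same sets
   S give cyclic flats in both matroids, with the same f(S). *)

Set Implicit Arguments.
Unset Strict Implicit.
Unset Printing Implicit Defensive.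

Import Order.TTheory.

(** * Cyclic sets as sets without coloops *)

Section Coloops.
Variables (T : finType) (M : matroid T).
Implicit Types (e : T) (X F : {set T}).

(** By [closureP], an [e] in [X] lies on a circuit inside [X] iff the rest of [X] spans it. *)
Lemma cyclic_rankP X :
  reflect {in X, forall e, rank M (X :\ e) = rank M X} (cyclic M X).
Proof.
have clE e : e \in X -> (e \in cl M (X :\ e)) = (rank M (X :\ e) == rank M X).
  by move=> eX; rewrite inE setD1K // eq_sym.
apply: (iffP (cyclicP M X)) => [cX e eX|noco].
  apply/eqP; rewrite -clE //; apply/closureP; right.
  have : e \in cyclic_part M X by rewrite cX.
  by case/bigcupP=> C /andP[hC sC] eC; exists C; rewrite // eC setD1K.
apply/eqP; rewrite eqEsubset cyclic_part_sub; apply/subsetP=> e eX.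
have /closureP[|[C hC /andP[eC]]] : e \in cl M (X :\ e) by rewrite clE // noco.
  by rewrite !inE eqxx.
by rewrite setD1K // => sC; apply/bigcupP; exists C; rewrite ?hC.
Qed.

End Coloops.

(** * Hall's theorem and the cyclic flats of a transversal matroid *)

Section Hall.
Variables (T J : finType) (A : J -> {set T}).
Implicit Types (e : T) (j : J) (I X Y : {set T}) (S : {set J}).

Local Notation M := (transversal_matroid A).

Definition neighbours X : {set J} := [set j | [exists e in X, e \in A j]].

Definition inside S : {set T} := [set e | [forall j, (e \in A j) ==> (j \in S)]].

Lemma neighboursP X j : reflect (exists2 e, e \in X & e \in A j) (j \in neighbours X).
Proof. by rewrite inE; apply: exists_inP. Qed.

Lemma insideP S e : reflect (forall j, e \in A j -> j \in S) (e \in inside S).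
Proof.
rewrite inE; apply: (iffP forallP) => h j; first exact/implyP/h.
by apply/implyP/h.
Qed.

(** Galois connection: [inside] is the upper adjoint of [neighbours]. *)
Lemma neighbours_inside X S : (neighbours X \subset S) = (X \subset inside S).
Proof.
apply/subsetP/subsetP => [h e eX|h j /neighboursP[e /h/insideP hS /hS]//].
by apply/insideP=> j ej; apply/h/neighboursP; exists e.
Qed.

(** Easy half of Hall's theorem: matched elements of [Y] occupy distinct indices of
    [neighbours Y]. *)
Lemma rank_le_neighbours X Y : rank M X <= #|neighbours Y| + #|X :\: Y|.
Proof.
have [B /andP[hB sBX] <-] := rank_basis M X.
rewrite -(cardsID Y B) leq_add ?subset_leq_card ?setSD //.
have [phi [phiA phi_inj]] := partial_transversalP _ _ hB.
have phi_injY : {in B :&: Y &, injective phi}.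
  by move=> x y /setIP[xB _] /setIP[yB _]; apply: phi_inj.
have some_inj : injective (@Some J) by move=> ? ? [].
rewrite -(card_in_imset phi_injY) -(card_imset (neighbours Y) some_inj).
apply/subset_leq_card/subsetP=> _ /imsetP[x /setIP[xB xY] ->].
by have [j -> xj] := phiA x xB; apply/imset_f/neighboursP; exists x.
Qed.

(* An edge e -> f of the alternating digraph: e could take over the place of f. *)
Definition alternating I (phi : T -> option J) : rel T :=
  fun e f => (f \in I) && [exists j, (phi f == Some j) && (e \in A j)].

(** Induction along the path: [u] takes over the index of [f], which leaves [f] as the unmatched
    head of a shorter path. *)
Lemma augmenting_path p I phi u j :
    matches A I phi -> u \notin I -> path (alternating I phi) u p ->
    uniq (u :: p) -> last u p \in A j -> {in I, forall e, phi e != Some j} ->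
  partial_transversal A (u |: I).
Proof.
elim: p I phi u => [|f p IHp] I phi u [phiA phi_inj] uNI /=.
  move=> _ _ uj jN; apply/partial_transversalP.
  exists (fun x => if x == u then Some j else phi x); split=> [x|x y]; rewrite !inE.
    by case: eqP => [-> _|_ /= /phiA//]; exists j.
  do 2!case: eqP => [->|_] //=; last exact: phi_inj.
    by move=> _ yI /esym/eqP; rewrite (negPf (jN y yI)).
  by move=> xI _ /eqP; rewrite (negPf (jN x xI)).
case/andP=> [/andP[fI /existsP[i /andP[/eqP phif ui]]] pth].
rewrite inE negb_or -!andbA => /and4P[uf uNp fNp up] lj jN.
pose phi' x := if x == u then Some i else phi x.
have m' : matches A (u |: I :\ f) phi'.
  rewrite /phi'; split=> [x|x y]; rewrite !inE.
    by case: eqP => [-> _|_ /= /andP[_ /phiA//]]; exists i.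
  have fN z : z != f -> z \in I -> phi z <> Some i.
    by move=> zf zI; rewrite -phif => /(phi_inj _ _ zI fI)/eqP; apply/negP.
  case: (x =P u) => [->|_]; case: (y =P u) => [->|_] //=.
  - by move=> _ /andP[yf yI] /esym/(fN y yf yI).
  - by move=> /andP[xf xI] _ /(fN x xf xI).
  by move=> /andP[_ xI] /andP[_ yI]; apply: phi_inj.
have -> : u |: I = f |: (u |: I :\ f) by rewrite setUCA setD1K.
apply: (IHp _ phi') => //=; last 2 first.
- by rewrite fNp.
- move=> x; rewrite !inE /phi'; case: eqP => [_ _|_ /= /andP[_ /jN//]].
  by rewrite -phif jN.
- by rewrite !inE eqxx eq_sym (negPf uf).
apply/(pathP f) => k ltk; move/(pathP f): pth => /(_ k ltk).
have yp := mem_nth f ltk; move: (nth f p k) (nth f (f :: p) k) yp => y x yp.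
have yu : y != u by apply: contraNneq uNp => <-.
have yf : y != f by apply: contraNneq fNp => <-.
by rewrite /alternating !inE /phi' (negPf yu) yf.
Qed.

(* Defect form of Hall's theorem, by König's argument: Y consists of the
   elements reachable by alternating paths from X minus a maximal matching. *)
Lemma rank_ge_neighbours X :
  exists2 Y : {set T}, Y \subset X & #|neighbours Y| + #|X :\: Y| <= rank M X.
Proof.
have [B /andP[hB sBX] cB] := rank_basis M X.
have [phi mphi] := partial_transversalP _ _ hB; have [phiA phi_inj] := mphi.
pose Y := [set y in X | [exists u in X :\: B, connect (alternating B phi) u y]].
have sYX : Y \subset X by apply/subsetP=> y; rewrite inE => /andP[].
have UY : X :\: B \subset Y.
  apply/subsetP=> u uU; rewrite inE; apply/andP; split; first by case/setDP: uU.
  by apply/exists_inP; exists u; rewrite ?connect0.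
exists Y => //; rewrite -cB -(cardsID Y B) leq_add //; last first.
  apply/subset_leq_card/subsetP=> x /setDP[xX xNY]; rewrite inE xNY /=.
  by apply: contraR xNY => xNB; apply: (subsetP UY); rewrite inE xNB.
have sN : [set Some j | j in neighbours Y] \subset [set phi x | x in B :&: Y].
  apply/subsetP=> x /imsetP[j /neighboursP[y]].
  rewrite inE => /andP[yX /exists_inP[u /setDP[uX uNB] cuy]] yj {x}->.
  have [/exists_inP[x xB /eqP phix]|] := boolP [exists x in B, phi x == Some j].
    apply/imsetP; exists x; rewrite // !inE xB (subsetP sBX) //=.
    apply/exists_inP; exists u; rewrite ?inE ?uX ?uNB //.
    apply: connect_trans cuy (connect1 _); rewrite /alternating xB /=.
    by apply/existsP; exists j; rewrite phix eqxx.
  rewrite negb_exists_in => /forall_inP jN; case/connectP: cuy yj => p /shortenP[q pq uq _] ->.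
  move=> lj; have := augmenting_path mphi uNB pq uq lj jN.
  move/(leq_rank (M := M) (X := X)); rewrite cardsU1 uNB -cB add1n ltnn.
  by rewrite subUset sub1set uX sBX => /(_ isT).
have some_inj : injective (@Some J) by move=> ? ? [].
rewrite -(card_imset _ some_inj) (leq_trans (subset_leq_card sN)) //.
exact: leq_imset_card.
Qed.

Lemma inside_mono S S' : S \subset S' -> inside S \subset inside S'.
Proof.
move=> sS; rewrite -neighbours_inside (subset_trans _ sS) //.
by rewrite neighbours_inside.
Qed.

(* [tight S] says that [inside S] is a cyclic flat of rank #|S|. *)
Definition tight S : bool :=
  [forall S' : {set J}, (S' \proper S) ==> (#|inside S'| + #|S| < #|inside S| + #|S'|)].

(** An element of [F] outside Hall's set [Y] would be a coloop, since deleting it lowers the bound;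
    hence [Y = F]. *)
Lemma cyclic_flat_rank F : cyclic M F -> rank M F = #|neighbours F|.
Proof.
move=> /cyclic_rankP noco; have [Y sYF leY] := rank_ge_neighbours F.
have YF : Y = F.
  apply/eqP; rewrite eqEsubset sYF; apply/subsetP=> e eF; apply: contraLR leY => eNY.
  rewrite -ltnNge -(noco e eF) (leq_ltn_trans (rank_le_neighbours _ Y)) // ltn_add2l.
  apply/proper_card/properP; split; first by rewrite setSD ?subD1set.
  by exists e; rewrite !inE ?eF ?eNY ?eqxx.
apply/eqP; rewrite eqn_leq; apply/andP; split.
  by have := rank_le_neighbours F F; rewrite setDv cards0 addn0.
by move: leY; rewrite YF setDv cards0 addn0.
Qed.

(** An element whose indices all lie in [neighbours F] adds no index, hence no rank, so the flat
    contains it. *)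
Lemma cyclic_flat_inside F :
  flat M F -> cyclic M F -> inside (neighbours F) = F.
Proof.
move=> /forallP fF cF; apply/eqP; rewrite eqEsubset andbC -neighbours_inside subxx.
apply/subsetP=> e eG; apply: contraLR isT => /(implyP (fF e)).
rewrite cyclic_flat_rank // ltnNge.
have := rank_le_neighbours (e |: F) (e |: F); rewrite setDv cards0 addn0 => /leq_trans -> //.
apply/subset_leq_card; rewrite neighbours_inside subUset sub1set eG.
by rewrite -neighbours_inside /=.
Qed.

(** Some [e] in [F] has an index outside [S]. As [e] is no coloop, Hall's bound for [F :\ e] and
    [inside S] still bounds the rank of [F]; the deleted [e] gives strictness. *)
Lemma cyclic_flat_tight F : flat M F -> cyclic M F -> tight (neighbours F).
Proof.
move=> fF cF; apply/forallP=> S; apply/implyP=> /properP[sS [j jF jNS]].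
rewrite cyclic_flat_inside //; have rkF := cyclic_flat_rank cF.
have /neighboursP[e eF ej] := jF.
have eNS : e \notin inside S by apply/insideP=> /(_ j ej); apply/negP.
have := rank_le_neighbours (F :\ e) (inside S).
rewrite (cyclic_rankP _ _ cF e eF) rkF => le1.
have le2 : #|neighbours (inside S)| <= #|S|.
  by rewrite subset_leq_card ?neighbours_inside.
have sSF : inside S \subset F.
  by have := inside_mono sS; rewrite (cyclic_flat_inside fF cF).
have := cardsDS sSF; have := subset_leq_card sSF.
move: le1; rewrite setDDl setUC -setDDl.
have := cardsD1 e (F :\: inside S); rewrite inE eNS eF; lia.
Qed.

Section Tight.
Variables (S : {set J}) (tS : tight S).

(** The strict inequality in [tight] compensates in Hall's bound for the deleted element. *)
Lemma tight_rank e : e \in inside S -> #|S| <= rank M (inside S :\ e).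
Proof.
move=> eS; have [Y sY] := rank_ge_neighbours (inside S :\ e).
apply: leq_trans; have sNS : neighbours Y \subset S.
  by rewrite neighbours_inside (subset_trans sY) ?subD1set.
have [->|neq] := eqVneq (neighbours Y) S; first exact: leq_addr.
have pN : neighbours Y \proper S by rewrite properEneq neq.
have := implyP (forallP tS _) pN.
have : #|Y| <= #|inside (neighbours Y)| by rewrite subset_leq_card -?neighbours_inside.
have := cardsDS sY; have := subset_leq_card sY.
have := cardsD1 e (inside S); rewrite eS; lia.
Qed.

Lemma rank_inside : rank M (inside S) = #|S|.
Proof.
apply/eqP; rewrite eqn_leq; apply/andP; split.
  have := rank_le_neighbours (inside S) (inside S); rewrite setDv cards0 addn0.
  by move/leq_trans; apply; rewrite subset_leq_card ?neighbours_inside.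
have [S0|/set0Pn[e eS]] := eqVneq (inside S) set0; last first.
  by rewrite (leq_trans (tight_rank eS)) // rankS ?subD1set.
have [->|neq] := eqVneq S set0; first by rewrite cards0.
have p0 : set0 \proper S by rewrite proper0.
by have := implyP (forallP tS _) p0; rewrite S0 !cards0; lia.
Qed.

Lemma neighbours_of_inside : neighbours (inside S) = S.
Proof.
apply/eqP; rewrite eqEcard neighbours_inside subxx -rank_inside.
by have := rank_le_neighbours (inside S) (inside S); rewrite setDv cards0 addn0.
Qed.

(** Flatness: an outside element has an index not in [S], which a matching of a basis of [inside S]
    leaves free. *)
Lemma cyclic_flat_of_tight : flat M (inside S) && cyclic M (inside S).
Proof.
apply/andP; split; last first.
  apply/cyclic_rankP=> e eS; apply/eqP; rewrite eqn_leq rankS ?subD1set //=.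
  by rewrite rank_inside tight_rank.
apply/forallP=> e; apply/implyP=> eNS; rewrite rank_inside.
have /exists_inP[j ej jNS] : [exists (j | e \in A j), j \notin S].
  by move: eNS; rewrite inE negb_forall; under eq_existsb do rewrite negb_imply.
have [B /andP[hB sB] cB] := rank_basis M (inside S); rewrite rank_inside in cB.
have eNB : e \notin B by apply: contra eNS; apply: (subsetP sB).
have [phi mphi] := partial_transversalP _ _ hB; have [phiA phi_inj] := mphi.
have /(augmenting_path (p := [::]) mphi eNB isT isT ej) : {in B, forall x, phi x != Some j}.
  move=> x xB; have [i -> xi] := phiA x xB; apply: contraNneq jNS => -[<-].
  by have /insideP := subsetP sB x xB; apply.
move/(leq_rank (M := M) (X := e |: inside S)); rewrite cardsU1 eNB -cB => -> //.
exact: setUS.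
Qed.

End Tight.
End Hall.

(** * Transfer of cyclic flats between two presentations *)

Lemma bij_le_morph d d' (L : latticeType d) (L' : latticeType d') (f : L -> L') :
    bijective f -> {mono f : x y / (x <= y)%O} ->
  {morph f : x y / (x `&` y)%O} /\ {morph f : x y / (x `|` y)%O}.
Proof.
case=> g fK gK f_mono; split=> x y; apply/le_anti/andP; split.
- by rewrite lexI !f_mono leIl leIr.
- by rewrite -[leLHS]gK f_mono lexI -!f_mono gK leIl leIr.
- by rewrite -[leRHS]gK f_mono leUx -!f_mono gK leUl leUr.
- by rewrite leUx !f_mono leUl leUr.
Qed.

Fact flat_tight (T J : finType) (A : J -> {set T})
    (F : cyclic_flat (transversal_matroid A)) :
  tight A (neighbours A F).
Proof. by case/andP: (cflat_setP F); apply: cyclic_flat_tight. Qed.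

Definition transport (T U J : finType) (A : J -> {set T}) (B : J -> {set U})
    (eqAB : forall S, tight A S -> tight B S)
    (F : cyclic_flat (transversal_matroid A)) : cyclic_flat (transversal_matroid B) :=
  CyclicFlat (cyclic_flat_of_tight (eqAB _ (flat_tight F))).

Lemma transportK (T U J : finType) (A : J -> {set T}) (B : J -> {set U})
    (eqAB : forall S, tight A S -> tight B S) (eqBA : forall S, tight B S -> tight A S) :
  cancel (transport eqAB) (transport eqBA).
Proof.
move=> F; apply: val_inj => /=; have tF := flat_tight F.
rewrite neighbours_of_inside ?eqAB //.
by case/andP: (cflat_setP F); apply: cyclic_flat_inside.
Qed.

Theorem same_configuration_tight (T U J : finType) (A : J -> {set T}) (B : J -> {set U}) :
    #|T| = #|U| -> (forall S, tight A S = tight B S) ->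
    (forall S, tight A S -> #|inside A S| = #|inside B S|) ->
  same_configuration (transversal_matroid A) (transversal_matroid B).
Proof.
move=> eqTU eq_tight eq_inside; split=> //.
have tAB S : tight A S -> tight B S by rewrite eq_tight.
have tBA S : tight B S -> tight A S by rewrite eq_tight.
have bij : bijective (transport tAB).
  by exists (transport tBA); apply: transportK.
have mono : {mono transport tAB : F G / (F <= G)%O}.
  move=> F G; rewrite !cflat_leE /=.
  have [/andP[fG cG] tF] := (cflat_setP G, tAB _ (flat_tight F)).
  rewrite -neighbours_inside neighbours_of_inside // neighbours_inside.
  by rewrite cyclic_flat_inside.
have [mI mU] := bij_le_morph bij mono.
exists (transport tAB); split=> // F; have tF := flat_tight F.
  rewrite /= -eq_inside //; case/andP: (cflat_setP F) => fF cF.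
  by rewrite cyclic_flat_inside.
rewrite /= rank_inside ?tAB // cyclic_flat_rank //.
by case/andP: (cflat_setP F).
Qed.

(** From [B] to [A]: the deficiency of [S] is kept, while those of its subsets can only be
    smaller. *)
Lemma eq_tight_of_deficiency (T U J : finType) (A : J -> {set T}) (B : J -> {set U}) :
    (forall S, #|inside A S| <= #|inside B S|) ->
    (forall S, tight B S -> #|inside A S| = #|inside B S|) ->
    (forall S' S : {set J}, S' \subset S -> #|inside B S'| + #|S| <= #|inside B S| + #|S'|) ->
  forall S, tight A S = tight B S.
Proof.
move=> leAB eqAB monoB S; apply/idP/idP => [tA|tB]; last first.
  apply/forallP=> S'; apply/implyP=> /(implyP (forallP tB S')); rewrite (eqAB S tB).
  by apply: leq_ltn_trans; rewrite leq_add2r leAB.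
(* A minimal subset [S0] with the [B]-deficiency of [S] is tight for [B]. Both deficiencies agree
   there, so [S0] being proper would contradict tightness of [S] for [A]. *)
pose p (S' : {set J}) := (S' \subset S) && (#|inside B S'| + #|S| == #|inside B S| + #|S'|).
have [|S0 minS0 sS0] := minset_exists (P := p) (C := S); first by rewrite /p subxx eqxx.
have /andP[_ /eqP eqS0] := minsetp minS0.
have tB0 : tight B S0.
  apply/forallP=> S'; apply/implyP=> /[dup] /proper_sub sS' ltS'.
  have ltc := proper_card ltS'.
  have neq : #|inside B S'| + #|S| != #|inside B S| + #|S'|.
    apply/eqP=> eqS'; have := minsetinf minS0 _ sS'.
    rewrite /p (subset_trans sS' sS0) eqS' eqxx => /(_ isT) E.
    by rewrite E ltnn in ltc.
  have := monoB _ _ (subset_trans sS' sS0); have := monoB _ _ sS'; lia.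
have [<- //|neq] := eqVneq S0 S; have pS0 : S0 \proper S by rewrite properEneq neq.
have := implyP (forallP tA _) pS0; rewrite (eqAB S0 tB0); have := leAB S; lia.
Qed.

(** * Counting between monotone bounds *)

Lemma count_split (T : Type) (a b : pred T) s :
  count a s = count (predI a b) s + count (predI a (predC b)) s.
Proof. by elim: s => //= x s ->; case: (a x); case: (b x) => /=; lia. Qed.

(** The sets [g e <= q] and [f e < p] are initial segments, hence nested; if the second is the
    larger, nothing is counted and the subtraction truncates to 0. *)
Lemma count_between N (f g : nat -> nat) p q :
    (forall e e', e <= e' < N -> f e <= f e') ->
    (forall e e', e <= e' < N -> g e <= g e') ->
  count (fun e => (p <= f e) && (g e <= q)) (iota 0 N) =
  count (fun e => g e <= q) (iota 0 N) - count (fun e => f e < p) (iota 0 N).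
Proof.
move=> f_mono g_mono.
rewrite (count_split (fun e => g e <= q) (fun e => f e < p)).
rewrite (count_split (fun e => f e < p) (fun e => g e <= q)).
have <- : count (fun e => (p <= f e) && (g e <= q)) (iota 0 N)
        = count (predI (fun e => g e <= q) (predC (fun e => f e < p))) (iota 0 N).
  by apply: eq_count => e /=; rewrite -leqNgt andbC.
have eqI : count (predI (fun e => g e <= q) (fun e => f e < p)) (iota 0 N)
         = count (predI (fun e => f e < p) (fun e => g e <= q)) (iota 0 N).
  by apply: eq_count => e /=; rewrite andbC.
rewrite eqI subnDl.
have [/hasP[e0]|no] :=
  boolP (has (predI (fun e => f e < p) (predC (fun e => g e <= q))) (iota 0 N)).
  rewrite mem_iota /= add0n -ltnNge => lt0 /andP[fe0 ge0].
  suff -> : count (fun e => (p <= f e) && (g e <= q)) (iota 0 N) = 0 by [].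
  rewrite (eq_in_count (a2 := pred0)) ?count_pred0 // => e; rewrite mem_iota /= add0n => lte.
  apply/negP=> /andP[fe ge]; have [le|gt] := leqP e e0.
    by have := f_mono e e0; rewrite le lt0 => /(_ isT); lia.
  by have := g_mono e0 e; rewrite (ltnW gt) lte => /(_ isT); lia.
by move: no; rewrite has_count -eqn0Ngt => /eqP->; rewrite subn0.
Qed.

(** * Maximal runs of a predicate and the intervals inside them *)

Section Blocks.
Variable sigma : pred nat.

(* The least h such that all of h, ..., k - 1 satisfy sigma. *)
Fixpoint block_start k : nat :=
  if k is k'.+1 then if sigma k' then block_start k' else k else 0.

Lemma block_start_le k : block_start k <= k.
Proof. by elim: k => //= k IHk; case: ifP => // _; apply: leqW. Qed.

Lemma block_startP h k : reflect (forall i, h <= i < k -> sigma i) (block_start k <= h).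
Proof.
elim: k => [|k IHk] /=; first by left=> i; rewrite ltn0 andbF.
case: ifP => sk.
  apply: (iffP IHk) => H i /andP[hi ik]; last by apply: H; rewrite hi leqW.
  by move: ik; rewrite ltnS leq_eqVlt => /predU1P[->//|ik]; apply: H; rewrite hi.
apply: (iffP idP) => [lt i|H]; first by lia.
by rewrite ltnNge; apply/negP=> hk; rewrite H ?hk ?ltnSn in sk.
Qed.

Lemma block_start_mono k k' : k <= k' -> block_start k <= block_start k'.
Proof.
move=> lek; apply/block_startP=> i /andP[hi ik].
by have /block_startP := leqnn (block_start k'); apply; rewrite hi (leq_trans ik).
Qed.

Lemma block_start_eq k k' : block_start k <= k' <= k -> block_start k' = block_start k.
Proof.
move=> /andP[le1 le2]; apply/eqP; rewrite eqn_leq block_start_mono //=.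
apply/block_startP=> i /andP[hi ik]; have [lt|ge] := ltnP i k'.
  by have /block_startP := leqnn (block_start k'); apply; rewrite hi.
by have /block_startP := leqnn (block_start k); apply; rewrite ik (leq_trans le1).
Qed.

Lemma block_start_pred k p : block_start k = p.+1 -> ~~ sigma p.
Proof.
move=> eqk; apply/negP=> sp; have : block_start k <= p; last by rewrite eqk ltnn.
apply/block_startP=> i; rewrite leq_eqVlt => /andP[/predU1P[<-//|pi] ik].
by have /block_startP := leqnn (block_start k); apply; rewrite eqk pi.
Qed.

Lemma count_block k :
  count sigma (iota 0 k) = k - block_start k +
    (if block_start k is p.+1 then count sigma (iota 0 p) else 0).
Proof.
elim: k => // k IHk; rewrite -addn1 iotaD count_cat addn1 /= add0n addn0.
have := block_start_le k; case: ifP => sk; first by rewrite IHk; lia.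
by rewrite subnn addn0.
Qed.

(* The number of e < N whose interval [f e, g e) satisfies sigma and ends by k. *)
Definition covered N (f g : nat -> nat) k : nat :=
  count (fun e => (g e <= k) && (block_start (g e) <= f e)) (iota 0 N).

(* No covered interval meets [block_start k - 1], so it lies in the last block or
   ends before that point. *)
Lemma covered_rec N f g k : (forall e, e < N -> f e <= g e) ->
  covered N f g k =
    count (fun e => (block_start k <= f e) && (g e <= k)) (iota 0 N) +
    (if block_start k is p.+1 then covered N f g p else 0).
Proof.
move=> fg; rewrite /covered (count_split _ (fun e => block_start k <= f e)); congr addn.
  apply: eq_count => e /=; have [gk|] //= := leqP (g e) k; last by rewrite andbF.
  rewrite andbT; have [le|//] := leqP (block_start k) (f e); last by rewrite andbF.
  by rewrite (leq_trans (block_start_mono gk)).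
have := block_start_le k; case eqp: (block_start k) => [|p] lepk.
  by rewrite (eq_count (a2 := pred0)) ?count_pred0 // => e /=; rewrite andbF.
apply: eq_in_count => e; rewrite mem_iota /= add0n => /fg fge.
have [gp|pg] := leqP (g e) p; first by lia.
apply/negP=> /andP[/andP[gk be]]; rewrite -ltnNge ltnS => fp.
by rewrite (@block_start_eq k) ?eqp ?pg in be; lia.
Qed.

(** * Comparison of covered steps with covered columns *)

Section Compare.
Variables (n m r : nat) (f g : nat -> nat) (cf cg : nat -> nat).
Hypotheses (f_mono : forall e e', e <= e' < n -> f e <= f e')
           (g_mono : forall e e', e <= e' < n -> g e <= g e')
           (cf_mono : forall j j', j <= j' < m -> cf j <= cf j')
           (cg_mono : forall j j', j <= j' < m -> cg j <= cg j').
Hypotheses (fg : forall e, e < n -> f e <= g e) (cfg : forall j, j < m -> cf j <= cg j).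
Hypotheses
  (count_f : forall p, p <= r ->
     count (fun e => f e < p) (iota 0 n) = count (fun j => cf j < p) (iota 0 m) + p)
  (count_g : forall q, q <= r ->
     count (fun e => g e <= q) (iota 0 n) = count (fun j => cg j <= q) (iota 0 m) + q).

(** On a block of length [l], [count_between] gives [max(0, d + l)] for steps and [max(0, d)] for
    columns, the shift [l] coming from [count_f] and [count_g] at the two ends of the block. *)
Lemma covered_le k : k <= r -> covered n f g k <= covered m cf cg k + count sigma (iota 0 k).
Proof.
have [N] := ubnP k; elim: N k => // N IHN k ltk lekr.
rewrite !covered_rec // count_block !count_between //.
have bk := block_start_le k.
rewrite count_f ?count_g ?(leq_trans bk) //.
case eqp: (block_start k) bk => [|p] bk; first by lia.
by have := IHN p; lia.
Qed.

(** A column inside a nonempty block makes its column count positive, so neither subtraction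
    truncates. The condition on [q] says that the run ending at [q] is maximal below [k]. *)
Lemma covered_eq k : k <= r ->
    (forall q, q <= k -> block_start q < q -> (q == k) || ~~ sigma q ->
      exists2 j, j < m & block_start q <= cf j /\ cg j <= q) ->
  covered n f g k = covered m cf cg k + count sigma (iota 0 k).
Proof.
have [N] := ubnP k; elim: N k => // N IHN k ltk lekr full.
rewrite !covered_rec // count_block.
have bk := block_start_le k.
have -> : count (fun e => (block_start k <= f e) && (g e <= k)) (iota 0 n) =
  count (fun j => (block_start k <= cf j) && (cg j <= k)) (iota 0 m) + (k - block_start k).
  have : block_start k < k ->
    0 < count (fun j => (block_start k <= cf j) && (cg j <= k)) (iota 0 m).
    have eqk : (k == k) || ~~ sigma k by rewrite eqxx.
    move=> lt; rewrite -has_count; have [j jm [j1 j2]] := full k (leqnn k) lt eqk.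
    by apply/hasP; exists j; rewrite ?mem_iota // j1.
  by rewrite !count_between // count_f ?count_g ?(leq_trans bk) //; lia.
case eqp: (block_start k) bk => [|p] bk; first by lia.
rewrite (IHN p); first by lia.
- by rewrite (leq_trans bk).
- by rewrite (leq_trans (ltnW bk)).
move=> q qp bq sq; apply: full => //; first by rewrite (leq_trans qp) ?(ltnW bk).
(* If [q = p], then [q] lies just below the block of [k] and fails [sigma]. *)
apply/orP; right; move: sq => /predU1P[->|//]; exact: block_start_pred eqp.
Qed.

End Compare.
End Blocks.

(** * Positions, heights and column heights along a word *)

Section Words.
Implicit Types (w : seq step) (s : step).

Lemma step_positions_rcons s w x :
  step_positions s (rcons w x) =
  step_positions s w ++ (if x == s then [:: size w] else [::]).
Proof.
rewrite /step_positions size_rcons -addn1 iotaD filter_cat /= add0n; congr cat.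
  by apply: eq_in_filter => k; rewrite mem_iota /= add0n nth_rcons => ->.
by rewrite nth_rcons ltnn eqxx.
Qed.

Lemma size_step_positions s w : size (step_positions s w) = count_mem s w.
Proof.
elim/last_ind: w => // w x IHw.
by rewrite step_positions_rcons size_cat IHw -cats1 count_cat /= addn0; case: eqP.
Qed.

Lemma take_rcons_le e w x : e <= size w -> take e (rcons w x) = take e w.
Proof. by move=> le; rewrite -cats1 takel_cat. Qed.

Lemma step_position_lt s w i e : i < count_mem s w ->
  (nth 0 (step_positions s w) i < e) = (i < count_mem s (take e w)).
Proof.
elim/last_ind: w e => // w x IHw e.
rewrite -{1}cats1 count_cat /= addn0 step_positions_rcons nth_cat size_step_positions => lti.
have lew : count_mem s (take e w) <= count_mem s w.
  by rewrite -{2}(cat_take_drop e w) count_cat leq_addr.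
have [lt|ge] := ltnP i (count_mem s w).
  have [le|gt] := leqP e (size w); first by rewrite take_rcons_le // IHw.
  rewrite take_oversize ?size_rcons // -cats1 count_cat (leq_trans lt) ?leq_addr //.
  by rewrite (leq_trans _ gt) // ltnS ltnW // IHw // take_size.
move: lti; case: eqP => [->|_] /= lti; last by rewrite addn0 ltnNge ge in lti.
have -> : i = count_mem s w by apply/eqP; rewrite eqn_leq ge andbT -ltnS -(addn1 (count _ _)).
rewrite subnn /=; have [le|gt] := leqP e (size w).
  by rewrite take_rcons_le // ltnNge lew.
by rewrite take_oversize ?size_rcons // -cats1 count_cat /= eqxx addn1 ltnSn.
Qed.

Lemma height_mono w k k' : k <= k' -> height w k <= height w k'.
Proof.
move=> le; rewrite /height -(subnKC le) takeD count_cat; exact: leq_addr.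
Qed.

Lemma height_succ w e : e < size w ->
  height w e.+1 = height w e + (nth East w e == North).
Proof.
by move=> lt; rewrite /height (take_nth East) // -cats1 count_cat /= addn0.
Qed.

Lemma count_east_take w e : e <= size w -> count_mem East (take e w) + height w e = e.
Proof.
move=> le; rewrite /height -[RHS](size_takel le) -(count_predC (pred1 East)).
by congr addn; apply: eq_count; case.
Qed.

Lemma count_north_height w p : p <= count_mem North w ->
  count (predI (fun e => height w e < p) (fun e => nth East w e == North))
        (iota 0 (size w)) = p.
Proof.
(* Writing the right-hand side as [minn p (count_mem North w)] removes the bound on [p], so the
   induction reaches shorter words. *)
move/minn_idPl=> {2}<-; elim/last_ind: w => [|w x IHw]; first by rewrite minn0.
rewrite size_rcons -addn1 iotaD count_cat add0n /= addn0.
rewrite nth_rcons ltnn eqxx -[in RHS]cats1 count_cat /= addn0.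
rewrite (eq_in_count (a2 := predI (fun e => height w e < p) (fun e => nth East w e == North))).
  rewrite IHw /height take_rcons_le // take_size.
  by case: eqP => _; rewrite ?andbT ?andbF /=; case: ltnP; lia.
move=> e; rewrite mem_iota /= add0n => lt.
by rewrite nth_rcons lt /height take_rcons_le // ltnW.
Qed.

Lemma count_east_pos w (a : pred nat) :
  count (fun j => a (east_pos w j)) (iota 0 (count_mem East w)) =
  count (predI a (fun e => nth East w e == East)) (iota 0 (size w)).
Proof.
rewrite -size_step_positions -(count_map (east_pos w)) -/(mkseq _ _) mkseq_nth.
by rewrite count_filter.
Qed.

Lemma count_height_lt w p : p <= count_mem North w ->
  count (fun e => height w e < p) (iota 0 (size w)) =
  count (fun j => column_height w j < p) (iota 0 (count_mem East w)) + p.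
Proof.
move=> lep; rewrite (count_split _ (fun e => nth East w e == East)).
rewrite -count_east_pos; congr addn; rewrite -[RHS](count_north_height lep).
by apply: eq_count => e /=; case: (nth East w e).
Qed.

(** A north step ends at height at most [q] iff it starts strictly below [q]; an east step keeps its
    height. *)
Lemma count_height_succ_le w q : q <= count_mem North w ->
  count (fun e => height w e.+1 <= q) (iota 0 (size w)) =
  count (fun j => column_height w j <= q) (iota 0 (count_mem East w)) + q.
Proof.
move=> leq; rewrite (count_split _ (fun e => nth East w e == East)); congr addn.
  rewrite (count_east_pos w (fun e => height w e <= q)).
  apply: eq_in_count => e; rewrite mem_iota /= add0n => lt; rewrite height_succ //.
  by case: (nth East w e); rewrite /= ?addn0 ?andbF.
rewrite -[RHS](count_north_height leq).
apply: eq_in_count => e; rewrite mem_iota /= add0n => lt; rewrite height_succ //.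
by case: (nth East w e); rewrite /= ?addn1 ?andbF.
Qed.

Lemma east_pos_lt w j e : j < count_mem East w ->
  (east_pos w j < e) = (j < count_mem East (take e w)).
Proof. exact: step_position_lt. Qed.

Lemma east_pos_size w j : j < count_mem East w -> east_pos w j < size w.
Proof. by move=> jm; rewrite east_pos_lt // take_size. Qed.

Lemma column_height_mono w j j' :
  j <= j' < count_mem East w -> column_height w j <= column_height w j'.
Proof.
move=> /andP[le lt]; apply: height_mono; have lt' := leq_ltn_trans le lt.
by rewrite -ltnS east_pos_lt // (leq_ltn_trans le) // -east_pos_lt.
Qed.

(** Just after [Q] crosses column [j], [P] is no higher, so it has made at least as many east steps
    and has crossed the column too. *)
Lemma column_height_le P Q j :
    size P = size Q -> never_above P Q ->
    j < count_mem East P -> j < count_mem East Q ->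
  column_height P j <= column_height Q j.
Proof.
move=> eqsz PQ jP jQ; apply: leq_trans (PQ _); apply: height_mono.
have ltQ := east_pos_size jQ; have ltP : east_pos Q j < size P by rewrite eqsz.
rewrite -ltnS east_pos_lt //; have := ltnSn (east_pos Q j); rewrite east_pos_lt //.
have := count_east_take ltQ; have := count_east_take ltP; have := PQ (east_pos Q j).+1.
lia.
Qed.

End Words.

(** * Deficiencies in the lattice path matroid and the rook matroid *)

Lemma card_ord_count n (a : pred nat) (X : {set 'I_n}) :
  (forall i : 'I_n, (i \in X) = a i) -> #|X| = count a (iota 0 n).
Proof.
move=> Xa; rewrite -val_enum_ord count_map cardE -size_filter; congr size.
by rewrite -(eq_filter Xa) enumT.
Qed.

Section Main.
Variables (n r : nat) (P Q : n.-tuple step).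
Hypotheses (endP : endpoint P = (n - r, r)) (endQ : endpoint Q = (n - r, r)).
Hypothesis PQ : never_above P Q.

Let eastP : count_mem East P = n - r. Proof. by case: endP. Qed.
Let eastQ : count_mem East Q = n - r. Proof. by case: endQ. Qed.
Let northP : count_mem North P = r. Proof. by case: endP. Qed.
Let northQ : count_mem North Q = r. Proof. by case: endQ. Qed.

Let le_rn : r <= n.
Proof. by rewrite -northP -[leqRHS](size_tuple P) count_size. Qed.

(** The shift in [e.+1]: north step [i] of [Q] must be among the first [e.+1] steps, that of [P]
    must not be among the first [e]. *)
Lemma in_lpm_set (i : 'I_r) (e : 'I_n) :
  (e \in lpm_set P Q i) = (height P e <= i < height Q e.+1).
Proof.
rewrite inE -ltnS [north_pos Q i < _]step_position_lt ?northQ //.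
by rewrite [e <= north_pos P i]leqNgt [north_pos P i < _]step_position_lt ?northP // -leqNgt andbC.
Qed.

(** Numbers from [r] on count as outside [S], so no block extends past [r]. *)
Definition row_pred (S : {set 'I_r}) : pred nat := fun k => oapp (mem S) false (insub k).

Lemma row_predE (S : {set 'I_r}) (i : 'I_r) : row_pred S i = (i \in S).
Proof. by rewrite /row_pred valK. Qed.

Lemma row_intervalP (S : {set 'I_r}) h k : k <= r ->
  reflect (forall i : 'I_r, h <= i < k -> i \in S) (block_start (row_pred S) k <= h).
Proof.
move=> lek; apply: (iffP (block_startP _ _ _)) => H i.
  by move/H; rewrite row_predE.
by move=> /[dup] hi /andP[_ ik]; rewrite (row_predE S (Ordinal (leq_trans ik lek))) H.
Qed.

Lemma height_le w k : height w k <= count_mem North w.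
Proof. by rewrite -[in leqRHS](cat_take_drop k w) count_cat leq_addr. Qed.

Lemma card_inside_lpm (S : {set 'I_r}) :
  #|inside (lpm_set P Q) S| =
  covered (row_pred S) n (height P) (fun e => height Q e.+1) r.
Proof.
apply: card_ord_count => e; have le := height_le Q e.+1; rewrite northQ in le; rewrite le /=.
apply/insideP/(row_intervalP _ _ le) => H i; first by rewrite -in_lpm_set => /H.
by rewrite in_lpm_set => /H.
Qed.

Let column_le w j : count_mem North w = r -> column_height w j <= r.
Proof. by move=> <-; apply: height_le. Qed.

Lemma in_rook_set_row (i : 'I_r) (e : 'I_n) : e < r -> (e \in rook_set P Q i) = (e == i :> nat).
Proof.
move=> lt; rewrite inE; case: eqP => //= _; apply/existsP=> -[j /andP[/eqP E _]].
by rewrite E ltnNge leq_addr in lt.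
Qed.

Lemma in_rook_set_column (i : 'I_r) (e : 'I_n) j :
  e = r + j :> nat -> (e \in rook_set P Q i) = (column_height P j <= i < column_height Q j).
Proof.
move=> E; rewrite inE E; have -> : (r + j == i) = false by have := ltn_ord i; lia.
have jm : j < n - r by have := ltn_ord e; lia.
apply/existsP/idP => [[j' /andP[/eqP/addnI <-]]//|H].
by exists (Ordinal jm); rewrite /= eqxx.
Qed.

(** A row label has itself as its only index, so row labels contribute [#|S|]; the rest are covered
    columns. *)
Lemma card_inside_rook (S : {set 'I_r}) :
  #|inside (rook_set P Q) S| =
  covered (row_pred S) (n - r) (column_height P) (column_height Q) r +
  count (row_pred S) (iota 0 r).
Proof.
pose a e := if e < r then row_pred S e
  else block_start (row_pred S) (column_height Q (e - r)) <= column_height P (e - r).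
rewrite (@card_ord_count _ a); last first.
  move=> e; rewrite /a; case: ltnP => [lt|ge].
    rewrite (row_predE S (Ordinal lt)); apply/insideP/idP => [H|H i].
      by apply: H; rewrite in_rook_set_row.
    by rewrite in_rook_set_row // => /eqP E; rewrite (_ : i = Ordinal lt) //; apply/val_inj.
  have E : e = r + (e - r) :> nat by rewrite subnKC.
  apply/insideP/(row_intervalP _ _ (column_le _ northQ)) => H i.
    by rewrite -(in_rook_set_column i E) => /H.
  by rewrite (in_rook_set_column i E) => /H.
rewrite -[in iota 0 n](subnKC le_rn) iotaD count_cat addnC add0n; congr addn.
  rewrite -[r in iota r _]addn0 iotaDl count_map; apply: eq_count => j /=.
  by rewrite /a ltnNge leq_addr /= addKn column_le.
by apply: eq_in_count => e; rewrite mem_iota /a add0n /= => ->.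
Qed.

Let sizeP : size P = n. Proof. exact: size_tuple. Qed.
Let sizeQ : size Q = n. Proof. exact: size_tuple. Qed.

Let height_nondec e e' : e <= e' < n -> height P e <= height P e'.
Proof. by case/andP=> le _; apply: height_mono. Qed.

Let height_succ_nondec e e' : e <= e' < n -> height Q e.+1 <= height Q e'.+1.
Proof. by case/andP=> le _; apply: height_mono. Qed.

Let columnP_nondec j j' : j <= j' < n - r -> column_height P j <= column_height P j'.
Proof. by rewrite -eastP; apply: column_height_mono. Qed.

Let columnQ_nondec j j' : j <= j' < n - r -> column_height Q j <= column_height Q j'.
Proof. by rewrite -eastQ; apply: column_height_mono. Qed.

Let height_le_succ e : e < n -> height P e <= height Q e.+1.
Proof. by move=> _; apply: leq_trans (PQ e) (height_mono _ (leqnSn e)). Qed.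

Let column_PQ j : j < n - r -> column_height P j <= column_height Q j.
Proof. by move=> jm; apply: column_height_le; rewrite ?eastP ?eastQ ?sizeP ?sizeQ. Qed.

Let count_P p : p <= r ->
  count (fun e => height P e < p) (iota 0 n) =
  count (fun j => column_height P j < p) (iota 0 (n - r)) + p.
Proof. by rewrite -{1}northP => /count_height_lt; rewrite sizeP eastP. Qed.

Let count_Q q : q <= r ->
  count (fun e => height Q e.+1 <= q) (iota 0 n) =
  count (fun j => column_height Q j <= q) (iota 0 (n - r)) + q.
Proof. by rewrite -{1}northQ => /count_height_succ_le; rewrite sizeQ eastQ. Qed.

Lemma card_inside_lpm_le (S : {set 'I_r}) :
  #|inside (lpm_set P Q) S| <= #|inside (rook_set P Q) S|.
Proof.
rewrite card_inside_lpm card_inside_rook.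
exact: (@covered_le _ _ _ r).
Qed.

Lemma card_row_pred (S : {set 'I_r}) : #|S| = count (row_pred S) (iota 0 r).
Proof. by apply: card_ord_count => i; rewrite row_predE. Qed.

(** The contribution of the row labels cancels, and the number of covered columns is monotone in the
    set of rows. *)
Lemma rook_deficiency_mono (S' S : {set 'I_r}) : S' \subset S ->
  #|inside (rook_set P Q) S'| + #|S| <= #|inside (rook_set P Q) S| + #|S'|.
Proof.
move=> sS; rewrite !card_inside_rook -!card_row_pred -addnA [#|S'| + _]addnC addnA.
rewrite !leq_add2r; apply: sub_count => j /= /andP[le /(row_intervalP _ _ le) H].
by rewrite le; apply/(row_intervalP _ _ le) => i /H /(subsetP sS).
Qed.

(** Removing [i] must lower the number of covered columns, and a column lost in this way has [i] in
    its interval. *)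
Lemma tight_column (S : {set 'I_r}) (i : 'I_r) :
    tight (rook_set P Q) S -> i \in S ->
  exists2 j, j < n - r & column_height P j <= i < column_height Q j /\
    block_start (row_pred S) (column_height Q j) <= column_height P j.
Proof.
move=> /forallP tS iS; have := implyP (tS _) (properD1 iS).
rewrite !card_inside_rook -!card_row_pred -addnA [#|S :\ i| + _]addnC addnA !ltn_add2r.
pose inS (X : {set 'I_r}) j :=
  block_start (row_pred X) (column_height Q j) <= column_height P j.
have inSE X : covered (row_pred X) (n - r) (column_height P) (column_height Q) r =
    count (inS X) (iota 0 (n - r)).
  by apply: eq_count => j; rewrite /= column_le.
rewrite !inSE => ltS.
have /hasP[j] : has (predD (inS S) (inS (S :\ i))) (iota 0 (n - r)).
  rewrite has_count; move: ltS; rewrite (count_split (inS S) (inS (S :\ i))).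
  rewrite [count (predD _ _) _](eq_count (a2 := predI (inS S) (predC (inS (S :\ i))))).
    have : count (predI (inS S) (inS (S :\ i))) (iota 0 (n - r)) <=
           count (inS (S :\ i)) (iota 0 (n - r)).
      by apply: sub_count => j /= /andP[].
    by move=> le lt; rewrite lt0n; apply: contraTneq lt => ->; rewrite addn0 -leqNgt.
  by move=> j; rewrite /= andbC.
rewrite mem_iota add0n /= => jm /andP[nj jS]; exists j => //; split=> //.
apply: contraR nj => out; have le := column_le j northQ.
move/(row_intervalP _ _ le) in jS; apply/(row_intervalP _ _ le) => k hk.
rewrite !inE jS // andbT; apply: contraNneq out => <-; exact: hk.
Qed.

(** For [covered_eq], take the column that [tight_column] gives for the lowest row of a block: its
    rows lie in [S] and meet the block, so they cannot leave it. *)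
Lemma card_inside_lpm_eq (S : {set 'I_r}) : tight (rook_set P Q) S ->
  #|inside (lpm_set P Q) S| = #|inside (rook_set P Q) S|.
Proof.
move=> tS; rewrite card_inside_lpm card_inside_rook.
apply: (@covered_eq _ _ _ r) => //.
move=> q leq ltq sq; set h := block_start _ q in ltq *.
have hr : h < r by apply: leq_trans leq.
have hS : forall i : 'I_r, h <= i < q -> i \in S by apply/row_intervalP.
have [|j jm [/andP[jh hj] jS]] := tight_column (i := Ordinal hr) tS.
  by apply: hS; rewrite leqnn.
exists j => //; have le := column_le j northQ.
move/(row_intervalP _ _ le) in jS; split.
  (* Starting below [h], the column would contain row [h - 1], which is not in [S]. *)
  rewrite leqNgt; apply/negP => lt; have [p eqh] : exists p, h = p.+1 by exists h.-1; lia.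
  have := block_start_pred eqh; have pr : p < r by rewrite -ltnS -eqh leqW.
  by rewrite (row_predE S (Ordinal pr)) jS //= -ltnS -eqh lt ltnW.
(* Ending above [q], the column would put row [q] in [S], while [q < r] excludes the alternative
   [q = r] in [sq]. *)
rewrite leqNgt; apply/negP => lt; have qr : q < r by apply: leq_trans lt le.
move: sq; rewrite (ltn_eqF qr) (row_predE S (Ordinal qr)) jS //=.
by rewrite lt andbT (leq_trans jh) //= ltnW.
Qed.

End Main.

Theorem theorem4p7 (n r : nat) (P Q : n.-tuple step)
  (endP : endpoint P = (n - r, r)) (endQ : endpoint Q = (n - r, r))
  (PQ : never_above P Q) :
  same_configuration (lattice_path_matroid r P Q) (rook_matroid r P Q).
Proof.
have eq_card S := card_inside_lpm_eq endP endQ PQ (S := S).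
have eq_tight := eq_tight_of_deficiency (card_inside_lpm_le endP endQ PQ) eq_card
  (rook_deficiency_mono endP endQ).
by apply: same_configuration_tight => // S; rewrite eq_tight; apply: eq_card.
Qed.
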